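(* Let $\mathcal{X}$ be a Polish space. Suppose $\mathcal{L}:\mathcal{X}\to[-\infty,\infty)$ is measurable and either bounded below or bounded above, $P\in\mathcal{P}(\mathcal{X})$, $D$ is a pre-divergence such that $Q\mapsto D(Q\|P)$ is convex, and $c$ is a cost function with $c(x,x)=0$ for all $x\in\mathcal{X}$. Then for every $\lambda>0$ the function $\mathcal{L}^c_\lambda$ is universally measurable and \[ \sup_{Q\in\mathcal{P}(\mathcal{X}): D^c(Q\|P)<\infty}\{E_Q[\mathcal{L}]-\lambda D^c(Q\|P)\}=\sup_{Q\in\mathcal{P}(\mathcal{X}):D(Q\|P)<\infty}\{ E_{Q}[ \lambda\mathcal{L}_\lambda^c]- \lambda D(Q\|P)\}. \]
   Context: $\mathcal{X}$ is a Polish space with Borel $\sigma$-algebra; $\mathcal{P}(\mathcal{X})$ denotes the Borel probability measures. A pre-divergence is $D:\mathcal{P}(\mathcal{X})\times\mathcal{P}(\mathcal{X})\to[0,\infty]$ with $D(\mu\|\mu)=0$ for all $\mu$. A cost function is a lower semicontinuous $c:\mathcal{X}\times\mathcal{X}\to[0,\infty]$, with OT cost $C(\mu,\nu)=\inf\{\int c\,d\pi:\pi\in\mathcal{P}(\mathcal{X}\times\mathcal{X}),\pi_1=\mu,\pi_2=\nu\}$. $D^c(\nu\|\mu)=\inf_{\eta\in\mathcal{P}(\mathcal{X})}\{D(\eta\|\mu)+C(\eta,\nu)\}$. For $\lambda>0$, $\mathcal{L}^c_\lambda(x)=\sup_{y\in\mathcal{X}}\{\mathcal{L}(y)/\lambda-c(x,y)\}$;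 its expectation under $Q$ is taken with respect to the completion of $Q$. *)

(* Defs.v *)
From HB Require Import structures.
From mathcomp Require Import all_boot all_order all_algebra.
From mathcomp Require Import all_classical all_reals all_analysis.
From mathcomp Require Import measurable_realfun measure_extension.
Set Implicit Arguments.
Unset Strict Implicit.
Unset Printing Implicit Defensive.
Import Order.TTheory GRing.Theory Num.Theory.
Import numFieldNormedType.Exports.
Local Open Scope classical_set_scope.
Local Open Scope ring_scope.
Local Open Scope ereal_scope.

Notation Borel X := (g_sigma_algebraType (@open X)).

Section Defs.
Context {R : realType} {X : completePseudoMetricType R}.

(* Polish: X carries a complete (pseudo)metric compatible with its topology
   (the structure itself), the metric separates points, and X is separable. *)
Definition polish : Prop :=
  hausdorff_space X /\ exists S : set X, countable S /\ closure S = setT.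

Definition pmeasure := probability (Borel X) R.

Definition pre_divergence (D : pmeasure -> pmeasure -> \bar R) : Prop :=
  (forall mu nu, 0 <= D mu nu) /\ (forall mu, D mu mu = 0).

Definition convex_first_arg (D : pmeasure -> pmeasure -> \bar R) (P : pmeasure)
  : Prop :=
  forall (Q1 Q2 Q : pmeasure) (t : R), (0 <= t <= 1)%R ->
    (forall A, measurable A -> Q A = t%:E * Q1 A + (1 - t)%:E * Q2 A) ->
    D Q P <= t%:E * D Q1 P + (1 - t)%:E * D Q2 P.

Definition cost_function (c : X -> X -> \bar R) : Prop :=
  lower_semicontinuous (fun z : X * X => c z.1 z.2) /\ (forall x y, 0 <= c x y).

Definition coupling (mu nu : pmeasure)
    (pi : probability (Borel X * Borel X)%type R) : Prop :=
  (forall A : set (Borel X), measurable A -> pi (fst @^-1` A) = mu A) /\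
  (forall A : set (Borel X), measurable A -> pi (snd @^-1` A) = nu A).

Definition ot_cost (c : X -> X -> \bar R) (mu nu : pmeasure) : \bar R :=
  ereal_inf [set \int[pi]_z c z.1 z.2 | pi in [set pi | coupling mu nu pi]].

Definition Dc (D : pmeasure -> pmeasure -> \bar R) (c : X -> X -> \bar R)
    (nu mu : pmeasure) : \bar R :=
  ereal_inf [set D eta mu + ot_cost c eta nu | eta in [set: pmeasure]].

Definition Lc (L : X -> \bar R) (c : X -> X -> \bar R) (lam : R) (x : X)
  : \bar R :=
  ereal_sup [set L y * (lam^-1)%:E - c x y | y in [set: X]].

Definition universally_measurable (f : X -> \bar R) : Prop :=
  forall (mu : pmeasure) (B : set (\bar R)), measurable B ->
    completed_algebra_gen mu (f @^-1` B).

Definition cexpect (Q : pmeasure) (f : X -> \bar R) : \bar R :=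
  \int[@completed_measure_extension _ (Borel X) R Q]_x f x.

End Defs.

(* Main.v *)
Require Import Defs.
From HB Require Import structures.
From mathcomp Require Import all_boot all_order all_algebra.
From mathcomp Require Import all_classical all_reals all_analysis.
From mathcomp Require Import measurable_realfun measure_extension.
From mathcomp Require Import lra.
Import Order.TTheory GRing.Theory Num.Theory.
Import numFieldNormedType.Exports.
Local Open Scope classical_set_scope.
Local Open Scope ring_scope.
Local Open Scope ereal_scope.

(** Write [h (x, y) = L y / lam - c x y], so that [Lc L c lam x] is the supremum of
    the section [h (x, _)]. Its superlevel sets are projections of Borel sets, hence
    analytic, hence measurable for every completed measure. The inequality [<=] is
    integration of [L y <= lam * Lc x + lam * c (x, y)] against couplings. For [>=],
    choose almost everywhere a Borel [y x] with [h (x, y x) >= Lc x - e] and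
    transport [Q] along [y]. When [L] is bounded above, [c (x, y x)] is automatically
    integrable unless the expectation of [Lc] is [-oo]; when [L] is bounded below,
    replace [L] by [min L n] and let [n] tend to infinity.

    Measurability and selection come from the same argument: a projection is the
    result of the Souslin operation applied to closed sets indexed by finite
    sequences. Continuity of the outer measure along increasing unions bounds the
    branches coordinatewise at an arbitrarily small cost in measure; in the
    resulting finitely branching tree the leftmost infinite branch exists by König's
    lemma and depends measurably on the point. *)

Set Implicit Arguments.
Unset Strict Implicit.
Unset Printing Implicit Defensive.

(** * The Souslin operation *)

Definition least (P : nat -> Prop) : nat :=
  if pselect (exists n, `[< P n >]) is left h then ex_minn h else 0%N.

Lemma leastP (P : nat -> Prop) : (exists n, P n) ->
  P (least P) /\ forall m, P m -> (least P <= m)%N.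
Proof.
move=> [n Pn]; rewrite /least; case: pselect => [h|[]]; last first.
  by exists n; exact/asboolP.
by case: ex_minnP => m /asboolP Pm mP; split=> // k /asboolP; exact: mP.
Qed.

Lemma least_eqP (P : nat -> Prop) k : (exists n, P n) ->
  least P = k <-> P k /\ forall m, (m < k)%N -> ~ P m.
Proof.
move=> /leastP[Pl Pmin]; split=> [<-|[Pk kmin]].
  by split=> // m + Pm; rewrite ltnNge Pmin.
by apply/eqP; rewrite eqn_leq Pmin//= leqNgt; apply/negP => /kmin.
Qed.

Lemma measurable_bigcap_ltn d (T : measurableType d) n (F : nat -> set T) :
  (forall i, measurable (F i)) ->
  measurable [set x | forall i, (i < n)%N -> F i x].
Proof.
move=> mF; rewrite (_ : mkset _ = \bigcap_(i in `I_n) F i)//.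
exact: bigcap_measurableType.
Qed.

Lemma measurable_least d (T : measurableType d) (F : nat -> set T) (A : set T) k :
  measurable A -> (forall i, measurable (F i)) ->
  (forall x, A x -> exists n, F n x) ->
  measurable [set x | A x /\ least (F ^~ x) = k].
Proof.
move=> mA mF AF.
rewrite (_ : mkset _ =
  A `&` (F k `&` [set x | forall i, (i < k)%N -> (~` F i) x])).
  apply: measurableI => //; apply: measurableI => //.
  by apply: measurable_bigcap_ltn => i; exact: measurableC.
apply/seteqP; split=> x /=.
  by move=> [Ax /(least_eqP _ (AF _ Ax))].
by move=> [Ax Fx]; split=> //; apply/(least_eqP _ (AF _ Ax)).
Qed.

Section souslin.
Context {d} {T : measurableType d} {R : realType} (P : probability T R).
Variable M : seq nat -> set T.
Hypothesis mM : forall s, measurable (M s).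

Definition souslin : set T :=
  [set x | exists s : nat -> nat, forall n, M (mkseq s n) x].

(** Since the infimum over measurable covers is attained, this says that the outer measure of [A]
    exceeds [r]. *)
Definition outer_gt (r : \bar R) (A : set T) :=
  forall C, measurable C -> A `<=` C -> r < P C.

(** Otherwise every [A k] has a measurable cover of measure at most [r]. The tail intersections of
    these covers still cover and are increasing, so their union covers everything with measure at
    most [r]. *)
Lemma outer_gt_bigcup r (A : nat -> set T) :
  {homo A : i j / (i <= j)%N >-> i `<=` j} ->
  outer_gt r (\bigcup_i A i) -> exists k, outer_gt r (A k).
Proof.
move=> homoA rA; apply: contrapT => /forallNP noA.
have /choice[C CP] : forall k, exists C, [/\ measurable C, A k `<=` C & P C <= r].
  move=> k; have /existsNP[C /not_implyP[mC /not_implyP[AC /negP]]] := noA k.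
  by rewrite -leNgt => CR; exists C.
pose D k := \bigcap_(j in [set j | (k <= j)%N]) C j.
have mD k : measurable (D k).
  by apply: bigcap_measurableType => j _; have [] := CP j.
have AD k : A k `<=` D k.
  by move=> x Akx j /= kj; have [_ + _] := CP j; apply; exact: homoA Akx.
have DD : {homo D : i j / (i <= j)%N >-> (i <= j)%O}.
  move=> i j ij; apply/subsetPset => x Dx l /= jl.
  by apply: Dx => /=; exact: leq_trans jl.
have PD k : P (D k) <= r.
  have [mC _ +] := CP k; apply: le_trans; rewrite le_measure ?inE//.
  by move=> x; apply => /=.
have mUD : measurable (\bigcup_k D k) by exact: bigcup_measurable.
have : P (\bigcup_k D k) <= r.
  have /cvg_lim <- := nondecreasing_cvg_mu (mu := P) mD mUD DD => //.
  apply: lime_le; last exact: nearW.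
  by apply/cvg_ex; eexists; exact: nondecreasing_cvg_mu.
rewrite leNgt => /negP; apply; apply: rA => //.
by move=> x [k _ Akx]; exists k => //; exact: AD.
Qed.

Definition souslin_le (l : seq nat) : set T :=
  [set x | exists s : nat -> nat, (forall n, M (mkseq s n) x) /\
     forall i, (i < size l)%N -> (s i <= nth 0%N l i)%N].

Lemma souslin_le_rcons l :
  souslin_le l = \bigcup_k souslin_le (rcons l k).
Proof.
apply/seteqP; split=> x.
  move=> [s [Ms sl]]; exists (s (size l)) => //; exists s; split=> // i.
  rewrite size_rcons ltnS leq_eqVlt nth_rcons => /orP[/eqP->|il].
    by rewrite ltnn eqxx.
  by rewrite il; exact: sl.
move=> [k _ [s [Ms sl]]]; exists s; split=> // i il.
have := sl i; rewrite size_rcons nth_rcons il; apply.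
by rewrite ltnS ltnW.
Qed.

(** The bounds are chosen one coordinate at a time: relaxing the last bound exhausts the previous
    set increasingly, so some finite bound keeps the outer measure above [r]. *)
Lemma outer_gt_bounded r : outer_gt r souslin ->
  exists k : nat -> nat, forall n, outer_gt r (souslin_le (mkseq k n)).
Proof.
move=> r0.
have step l : exists k, outer_gt r (souslin_le l) -> outer_gt r (souslin_le (rcons l k)).
  have [rl|nrl] := pselect (outer_gt r (souslin_le l)); last by exists 0%N.
  move: rl; rewrite souslin_le_rcons => /outer_gt_bigcup[|k kP]; last by exists k.
  move=> i j ij x [s [Ms sl]]; exists s; split=> // m.
  rewrite size_rcons => ml; have := sl m; rewrite size_rcons => /(_ ml).
  by rewrite !nth_rcons; case: ltnP => // _; case: eqP => // _ /leq_trans; exact.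
have [h hP] := choice step.
pose l := fix l n := if n is n'.+1 then rcons (l n') (h (l n')) else [::].
have lP n : outer_gt r (souslin_le (l n)).
  elim: n => [|n IH] /=; last exact: hP.
  rewrite (_ : souslin_le _ = souslin)//.
  by apply/seteqP; split=> x; [move=> [s [? _]]|move=> [s ?]]; exists s.
exists (fun n => h (l n)) => n; rewrite (_ : mkseq _ n = l n)//.
by elim: n => // n IH; rewrite mkseqS IH.
Qed.

(** * The finitely branching tree and its leftmost branch *)

Section bounded_tree.
Variable k : nat -> nat.

(** Recursion on the depth keeps each level a finite union, hence measurable, where quantifying over
    infinite branches would not. *)
Fixpoint deep n (s : seq nat) : set T :=
  if n is n'.+1 then
    M s `&` \bigcup_(j in `I_(k (size s)).+1) deep n' (rcons s j)
  else M s.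

Definition live s := \bigcap_n deep n s.

Lemma measurable_deep n s : measurable (deep n s).
Proof.
elim: n s => //= n IH s; apply: measurableI => //.
by apply: bigcup_measurable => j _; exact: IH.
Qed.

Lemma measurable_live s : measurable (live s).
Proof. by apply: bigcapT_measurable => n; exact: measurable_deep. Qed.

Lemma deepS n s : deep n.+1 s `<=` deep n s.
Proof.
elim: n s => [|n IH] s x; first by case.
by move=> [Ms [j jk Dj]]; split=> //; exists j => //; exact: IH.
Qed.

Lemma le_deep m n s : (m <= n)%N -> deep n s `<=` deep m s.
Proof.
move=> /subnK <-; elim: (n - m)%N => // i IH x.
by rewrite addSn => /deepS; exact: IH.
Qed.

Lemma live_sub s : live s `<=` M s.
Proof. by move=> x /(_ 0%N); exact. Qed.

(* König's lemma: at most [(k (size s)).+1] children are available. *)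
Lemma live_rcons s x : live s x -> exists j, live (rcons s j) x.
Proof.
move=> lx; apply: contrapT => /forallNP nl.
have /choice[N NP] : forall j, exists n, ~ deep n (rcons s j) x.
  by move=> j; have /existsNP[n /not_implyP[_ ?]] := nl j; exists n.
pose m := \max_(j < (k (size s)).+1) N j.
have [_ [j jk /le_deep]] := lx m.+1 I.
have jm : (N j <= m)%N by exact: (leq_bigmax (Ordinal jk)).
by move=> /(_ _ jm)/NP.
Qed.

Lemma souslin_le_deep n : souslin_le (mkseq k n) `<=` deep n [::].
Proof.
move=> x [s [Ms]]; rewrite size_mkseq => sk.
suff H m p : (p + m <= n)%N -> deep m (mkseq s p) x.
  by have := H n 0%N; rewrite add0n; exact.
elim: m p => [|m IH] p pn; first exact: Ms.
split; first exact: Ms.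
exists (s p) => /=.
  rewrite size_mkseq ltnS; have := sk p; rewrite nth_mkseq; first apply.
    by rewrite (leq_trans _ pn)// addnS ltnS leq_addr.
  by rewrite (leq_trans _ pn)// addnS ltnS leq_addr.
by rewrite -mkseqS; apply: IH; rewrite addSnnS.
Qed.

(** Always taking the least live child turns the existence of a branch into a canonical choice,
    whose coordinates depend measurably on [x]. *)
Fixpoint leftmost (x : T) n : seq nat :=
  if n is n'.+1 then
    rcons (leftmost x n') (least (fun j => live (rcons (leftmost x n') j) x))
  else [::].

Definition branch (x : T) n := least (fun j => live (rcons (leftmost x n) j) x).

Lemma mkseq_branch x n : mkseq (branch x) n = leftmost x n.
Proof. by elim: n => // n IH; rewrite mkseqS IH. Qed.

Lemma live_leftmost x n : live [::] x -> live (leftmost x n) x.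
Proof. by move=> lx; elim: n => //= n IH; apply: (leastP (live_rcons IH)).1. Qed.

(** Induction on [n]: the event for [rcons s j] is the event for [s] cut by the condition that [j]
    is the least live child of [s]. *)
Lemma measurable_leftmost n s :
  measurable [set x | live [::] x /\ leftmost x n = s].
Proof.
elim: n s => [|n IH] s /=.
  have [->|s0] := eqVneq s [::].
    rewrite (_ : mkset _ = live [::]); first exact: measurable_live.
    by apply/seteqP; split=> x //= -[].
  rewrite (_ : mkset _ = set0)//; apply/seteqP; split=> x //= -[_ s0'].
  by move: s0; rewrite -s0' eqxx.
case: (lastP s) => [|{}s j].
  rewrite (_ : mkset _ = set0)//; apply/seteqP; split=> x //= -[_ /(congr1 size)].
  by rewrite size_rcons.
have := @measurable_least _ _ (fun j => live (rcons s j)) _ j (IH s)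
  (fun i => measurable_live _).
rewrite (_ : [set x | _ /\ _ = j] =
  [set x | live [::] x /\ leftmost x n.+1 = rcons s j]).
  apply => x [l0 <-]; exact/live_rcons/live_leftmost.
apply/seteqP; split=> x /=; first by move=> [[l0 ->] ->].
by move=> [l0 /rcons_inj[<- <-]].
Qed.

Lemma measurable_branch n j : measurable [set x | live [::] x /\ branch x n = j].
Proof.
rewrite (_ : mkset _ = \bigcup_(s in [set: seq nat])
    [set x | live [::] x /\ leftmost x n.+1 = rcons s j]).
  by apply: countable_bigcupT_measurable => // s; exact: measurable_leftmost.
apply/seteqP; split=> x /=.
  by move=> [l0 <-]; exists (leftmost x n).
by move=> [s _ [l0 /rcons_inj[_ <-]]].
Qed.

End bounded_tree.

(** The sets [deep k n [::]] decrease to [live k [::]], and each contains a bounded Souslin set of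
    outer measure above [r]; continuity from above keeps measure at least [r] in the limit. *)
Lemma souslin_inner r : outer_gt r souslin ->
  exists (B : set T) (f : T -> nat -> nat),
  [/\ measurable B, r <= P B,
      forall n j, measurable [set x | B x /\ f x n = j] &
      forall x, B x -> forall n, M (mkseq (f x) n) x].
Proof.
move=> /outer_gt_bounded[k kP]; exists (live k [::]), (branch k); split.
- exact: measurable_live.
- have cv : P \o (fun n => deep k n [::]) @ \oo --> P (live k [::]).
    apply: nonincreasing_cvg_mu.
    + by rewrite ltey_eq fin_num_measure//; exact: measurable_deep.
    + by move=> n; exact: measurable_deep.
    + exact: measurable_live.
    + by move=> m n mn; apply/subsetPset; exact: le_deep.
  have /cvg_lim <- := cv => //; apply: lime_ge; first by apply/cvg_ex; eexists; exact: cv.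
  apply: nearW => n; apply/ltW/(kP n); first exact: measurable_deep.
  exact: souslin_le_deep.
- exact: measurable_branch.
- by move=> x lx n; rewrite mkseq_branch; exact/live_sub/live_leftmost.
Qed.

(** With [r] the outer measure, inner sets of measure at least [r - e n] and covers of measure below
    [r + e n] squeeze the Souslin set between Borel sets with null difference. *)
Theorem souslin_selection : exists (B C : set T) (f : T -> nat -> nat),
  [/\ [/\ measurable B, measurable C, B `<=` souslin & souslin `<=` C],
      P (C `\` B) = 0,
      forall n j, measurable [set x | B x /\ f x n = j] &
      forall x, B x -> forall n, M (mkseq (f x) n) x].
Proof.
pose S := [set P C | C in [set C | measurable C /\ souslin `<=` C]].
pose r := ereal_inf S.
have r0 : 0 <= r by apply: le_ereal_inf_tmp => _ [C _ <-].
have r1 : r <= 1.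
  by apply: ereal_inf_lbound; exists setT; [split|exact: probability_setT].
have rfin : r \is a fin_num by rewrite ge0_fin_numE// (le_lt_trans r1)// ltry.
pose e n : R := (n.+1%:R^-1)%R.
have e0 n : (0 < e n)%R by rewrite invr_gt0.
have /choice[C CP] : forall n, exists C,
    [/\ measurable C, souslin `<=` C & P C < r + (e n)%:E].
  by move=> n; have [_ [C [mC SC] <-] ?] := lb_ereal_inf_adherent (e0 n) rfin; exists C.
have /choice[B BP] : forall n, exists B : set T, exists f : T -> nat -> nat,
  [/\ measurable B, r - (e n)%:E <= P B,
      forall n j, measurable [set x | B x /\ f x n = j] &
      forall x, B x -> forall n, M (mkseq (f x) n) x].
  (* Every measurable cover has measure at least [r], hence more than [r - e n]. *)
  move=> n; apply: souslin_inner => D mD SD.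
  apply: (@lt_le_trans _ _ r); first by rewrite lteBlDr// lteDl// lte_fin.
  by apply: ereal_inf_lbound; exists D.
have [f fP] := choice BP.
have mB n : measurable (B n) by have [] := fP n.
have mC n : measurable (C n) by have [] := CP n.
have MB n x : B n x -> forall m, M (mkseq (f n x) m) x by have [_ _ _] := fP n; exact.
have mUB : measurable (\bigcup_n B n) by exact: bigcup_measurable.
have mIC : measurable (\bigcap_n C n) by exact: bigcapT_measurable.
have BS : \bigcup_n B n `<=` souslin by move=> x [n _ Bx]; exists (f n x); exact: MB.
have SC : souslin `<=` \bigcap_n C n by move=> x Sx n _; have [_ + _] := CP n; exact.
have Bex x : (\bigcup_n B n) x -> exists n, B n x by move=> [n _]; exists n.
(* On the union, the branch comes from the first [B n] that contains [x], which keeps the selection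
   measurable. *)
exists (\bigcup_n B n), (\bigcap_n C n), (fun x => f (least (B ^~ x)) x); split=> //.
- apply/eqP; rewrite -measure_le0; apply/lee_addgt0Pr => eps eps0; rewrite add0e.
  have [n _ /(_ _ (leqnn _)) /= ne] := near_infty_natSinv_lt (PosNum (divr_gt0 eps0 (ltr0Sn R 1))).
  apply: (@le_trans _ _ (P (C n `\` B n))).
    rewrite le_measure ?inE//; try exact: measurableD.
    by apply: setDSS; [exact: bigcap_inf|exact: bigcup_sup].
  have BC : B n `<=` C n.
    by move=> x Bx; apply: (SC x (BS x _)) => //; exists n.
  rewrite measureD ?setIidr//; last by rewrite ltey_eq fin_num_measure.
  have [_ _ PC] := CP n; have [_ PB _ _] := fP n.
  apply: (le_trans (leeB (ltW PC) PB)).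
  have -> : r + (e n)%:E - (r - (e n)%:E) = (e n *+ 2)%:E.
    move: r rfin {r0 r1 CP BP fP PB PC} => [a| |]//= _; congr (_%:E).
    rewrite mulr2n; lra.
  rewrite lee_fin.
  have : (e n < eps / 2)%R by [].
  lra.
- move=> m j.
  rewrite (_ : mkset _ = \bigcup_n
    ([set x | (\bigcup_n B n) x /\ least (B ^~ x) = n] `&` [set x | B n x /\ f n x m = j])).
    apply: bigcup_measurable => n _; apply: measurableI.
      exact: measurable_least.
    by have [] := fP n.
  apply/seteqP; split=> x /=.
    move=> [Bx <-]; exists (least (B ^~ x)) => //; split=> //=; split=> //.
    exact: (leastP (Bex _ Bx)).1.
  by move=> [n _ [[Bx <-] []]].
- by move=> x Bx; apply: MB; exact: (leastP (Bex _ Bx)).1.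
Qed.

End souslin.

(** * Analytic sets *)

Section analytic.
Context {Z : topologicalType}.
Implicit Types (C : (nat -> nat) -> set Z) (A F : set Z).

(* Closedness in the product of Baire space and [Z]; basic neighbourhoods in
   Baire space fix finitely many coordinates. *)
Definition closed_rel C := forall s z,
  (forall n U, nbhs z U -> exists s' z',
    [/\ forall i, (i < n)%N -> s' i = s i, U z' & C s' z']) -> C s z.

Definition analytic A :=
  exists2 C, closed_rel C & A = [set z | exists s, C s z].

Lemma closed_analytic F : closed F -> analytic F.
Proof.
move=> cF; exists (fun _ => F).
  by move=> s z H; apply: cF => U /(H 0%N)[_ [z' [_ Uz' Fz']]]; exists z'.
by apply/seteqP; split=> z /=; [exists id|case].
Qed.

Lemma analytic_bigcup (A : nat -> set Z) :
  (forall n, analytic (A n)) -> analytic (\bigcup_n A n).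
Proof.
move=> aA; have /choice[C CP] : forall n, exists C,
    closed_rel C /\ A n = [set z | exists s, C s z].
  by move=> n; have [C] := aA n; exists C.
(* The first coordinate names the set [A n]; the remaining ones form a branch for it. *)
exists (fun s => C (s 0%N) (s \o succn)).
  move=> s z H; apply: (CP (s 0%N)).1 => n U /(H n.+1)[s' [z' [ss' Uz' Cz']]].
  by exists (s' \o succn), z'; split=> //= [i ni|]; [exact: ss'|rewrite -ss'].
apply/seteqP; split=> z.
  move=> [n _]; rewrite (CP n).2 => -[s Cs].
  by exists (fun i => if i is i'.+1 then s i' else n).
by move=> [s Cs]; exists (s 0%N) => //; rewrite (CP _).2; exists (s \o succn).
Qed.

Lemma analytic_bigcap (A : nat -> set Z) :
  (forall n, analytic (A n)) -> analytic (\bigcap_n A n).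
Proof.
move=> aA; have /choice[C CP] : forall n, exists C,
    closed_rel C /\ A n = [set z | exists s, C s z].
  by move=> n; have [C] := aA n; exists C.
(* One sequence carries a branch for every [A i] at once, interleaved by the pairing [pickle]. *)
exists (fun s z => forall i, C i (fun j => s (pickle (i, j))) z).
  move=> s z H i; apply: (CP i).1 => n U.
  (* Fixing [n] coordinates of the [i]-th branch means fixing [s] up to the largest index that
     encodes them. *)
  move=> /(H (\max_(j < n) pickle (i, nat_of_ord j)).+1)[s' [z' [ss' Uz' Cz']]].
  exists (fun j => s' (pickle (i, j))), z'; split=> // j jn.
  by apply: ss'; rewrite ltnS; exact: (leq_bigmax (Ordinal jn)).
apply/seteqP; split=> z; last first.
  by move=> [s Cs] i _; rewrite (CP i).2; eexists; exact: Cs.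
move=> Az; have /choice[t tP] : forall i, exists s, C i s z.
  by move=> i; have := Az i I; rewrite (CP i).2.
exists (fun m => if unpickle m is Some ij then t ij.1 ij.2 else 0%N) => i.
rewrite (_ : (fun j => _) = t i)//.
by apply/funext => j; rewrite pickleK.
Qed.

(** Analytic sets need not be stable under complement, so the complement is required to be analytic
    as well; countable unions and intersections then suffice. *)
Lemma sigma_algebra_analytic :
  sigma_algebra setT [set A | analytic A /\ analytic (~` A)].
Proof.
split=> [|A [aA aCA]|A aA] /=.
- by rewrite setC0; split; apply: closed_analytic; [exact: closed0|exact: closedT].
- by rewrite setTD setCK.
- split; first by apply: analytic_bigcup => n; exact: (aA n).1.
  by rewrite setC_bigcup; apply: analytic_bigcap => n; exact: (aA n).2.
Qed.

End analytic.

Section analytic_pseudometric.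
Context {R : realType}.

(** An open set of a pseudometric space is a countable union of closed sets. A point of [F n] is
    within [1/(n+1)] of some point whose ball of that radius lies in [U], so closing up does not
    leave [U]. *)
Lemma open_analytic (Z : pseudoMetricType R) (U : set Z) : open U -> analytic U.
Proof.
move=> oU; pose F n := closure [set z : Z | ball z (n.+1%:R^-1)%R `<=` U].
rewrite (_ : U = \bigcup_n F n).
  by apply: analytic_bigcup => n; apply: closed_analytic; exact: closed_closure.
apply/seteqP; split=> z.
  rewrite openE in oU => /oU/nbhs_ballP[e /= e0 eU].
  have [n _ /(_ _ (leqnn _)) /= ne] := near_infty_natSinv_lt (PosNum e0).
  exists n => //; apply: subset_closure => /= y zy.
  by apply: eU; apply: le_ball zy; exact: ltW.
move=> [n _] /(_ (ball z (n.+1%:R^-1)%R)).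
rewrite -nbhs_ballE => /(_ _)[].
  by exists (n.+1%:R^-1)%R => //=; rewrite invr_gt0.
by move=> y [yU zy]; apply: yU; exact: ball_sym.
Qed.

(** The product sigma-algebra is generated by cylinders over Borel sets, and these in turn by
    cylinders over open sets, which are open in the product. *)
Lemma measurable_prod_analytic (X Y : pseudoPMetricType R)
    (B : set (Borel X * Borel Y)) :
  measurable B -> analytic (B : set (X * Y)%type).
Proof.
pose G := [set A : set (X * Y)%type | analytic A /\ analytic (~` A)].
have sG : sigma_algebra setT G by exact: sigma_algebra_analytic.
suff : measurable `<=` (G : set (set (Borel X * Borel Y))).
  by move=> /[apply] -[].
have openG (W : set (X * Y)%type) : open W -> G W.
  move=> oW; split; first exact: open_analytic.
  by apply: closed_analytic; rewrite closedC.
apply: smallest_sub => // A [] [B' mB' <-]; rewrite setTI.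
- suff : measurable `<=` [set A : set (Borel X) | G (fst @^-1` A)] by exact.
  apply: smallest_sub; last by move=> U oU; apply: openG;
    apply: open_comp oU => x _; exact: cvg_fst.
  case: sG => G0 GC GU; split => /=.
  + by rewrite preimage_set0.
  + by move=> E /GC; rewrite !setTD preimage_setC.
  + by move=> E /GU; rewrite preimage_bigcup.
- suff : measurable `<=` [set A : set (Borel Y) | G (snd @^-1` A)] by exact.
  apply: smallest_sub; last by move=> U oU; apply: openG;
    apply: open_comp oU => x _; exact: cvg_snd.
  case: sG => G0 GC GU; split => /=.
  + by rewrite preimage_set0.
  + by move=> E /GC; rewrite !setTD preimage_setC.
  + by move=> E /GU; rewrite preimage_bigcup.
Qed.

End analytic_pseudometric.

(** * Projections and measurable selection *)

Lemma closed_measurable_Borel (X : ptopologicalType) (F : set X) :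
  closed F -> measurable (F : set (Borel X)).
Proof.
move=> cF; rewrite -(setCK F); apply: measurableC.
by apply: sub_sigma_algebra; exact: closed_openC.
Qed.

Lemma closure_ball_sub (R : realType) (X : pseudoMetricType R) (x : X) (e : R) :
  (0 < e)%R -> closure (ball x e) `<=` ball x (e + e).
Proof.
move=> e0 y /(_ (ball y e) (nbhsx_ballx _ _ e0))[z [xz yz]].
by apply: ball_triangle xz _; exact: ball_sym.
Qed.

Section projection.
Context {R : realType} {X : pseudoPMetricType R} {Y : completePseudoMetricType R}.
Variable q : nat -> Y.
Hypothesis q_dense : forall y (e : R), (0 < e)%R -> exists n, ball (q n) e y.

Let e n : R := (n.+1%:R^-1)%R.

Let e0 n : (0 < e n)%R. Proof. by rewrite invr_gt0. Qed.

Let lt_e (r : R) : (0 < r)%R -> \forall n \near \oo, (e n < r)%R.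
Proof. by move=> r0; exact: (near_infty_natSinv_lt (PosNum r0)). Qed.

(** Closures are taken so that membership survives passage to the limit. *)
Definition net n k : set Y := closure (ball (q k) (e n)).

(* The even coordinates of [s] locate the eliminated point [y]. *)
Definition proj_rel (C : (nat -> nat) -> set (X * Y)) (s : nat -> nat) : set X :=
  [set x | exists2 y, (forall n, net n (s n.*2) y) &
                      C (fun n => s n.*2.+1) (x, y)].

(** Approximants of [(s, x)] come with points [y'] lying in the nets prescribed by [s]. The radii
    tend to zero, so these points form a Cauchy sequence; completeness gives the limit and
    closedness of [C] finishes. *)
Lemma closed_proj_rel C : closed_rel C -> closed_rel (proj_rel C).
Proof.
move=> cC s x H.
have /choice[u uP] : forall n, exists u : (nat -> nat) * X * Y,
    [/\ forall i, (i < n.+1.*2)%N -> u.1.1 i = s i, ball x (e n) u.1.2,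
        (forall m, net m (u.1.1 m.*2) u.2) &
        C (fun m => u.1.1 m.*2.+1) (u.1.2, u.2)].
  move=> n; have [s' [x' [ss' xx' [y' ny' Cy']]]] :=
    H n.+1.*2 (ball x (e n)) (nbhsx_ballx _ _ (e0 n)).
  by exists (s', x', y').
pose v n := (u n).2.
(* The coordinate [m.*2] of the [n]-th approximant agrees with that of [s] as soon as [m <= n]. *)
have netv m : \forall n \near \oo, net m (s m.*2) (v n).
  exists m => // n /= mn; have [us _ + _] := uP n => /(_ m).
  by rewrite us// doubleS ltnS (leq_trans _ (leqnSn _))// leq_double.
have /cauchy_cvg/cvg_ex[y vy] : cauchy (v @ \oo).
  apply: cauchy_exP => r r0.
  have [m _ /(_ _ (leqnn _)) /= mr] := lt_e (divr_gt0 r0 (ltr0Sn R 1)).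
  exists (q (s m.*2)); apply: filterS (netv m) => n /(closure_ball_sub (e0 m)).
  by apply: le_ball; lra.
exists y => [m|].
  by apply: closed_cvg vy; [exact: closed_closure|exact: netv].
apply: cC => n U; have xv : (fun k => ((u k).1.2, v k)) @ \oo --> (x, y).
  apply: cvg_pair vy; apply/cvg_ballP => r r0.
  by apply: filterS (lt_e r0) => k /ltW/le_ball; apply; have [] := uP k.
move=> /xv /= [N _ UN].
have [us _ _ Cu] := uP (maxn n N).
exists (fun m => (u (maxn n N)).1.1 m.*2.+1), ((u (maxn n N)).1.2, v (maxn n N)).
split=> //; last by apply: UN; rewrite /= leq_maxr.
move=> i ni; apply: us; rewrite ltn_Sdouble ltnS ltnW//.
exact: leq_trans (leq_maxl _ _).
Qed.

(** Density provides net centres near any [y] at every scale, so recording them in the even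
    coordinates excludes no point. *)
Lemma proj_relE C :
  [set x | exists s, proj_rel C s x] = [set x | exists y s, C s (x, y)].
Proof.
apply/seteqP; split=> x; first by move=> [s [y _ Cs]]; exists y, (fun n => s n.*2.+1).
move=> [y [s Cs]].
have /choice[t tP] : forall n, exists k, ball (q k) (e n) y.
  by move=> n; exact: q_dense.
exists (fun n => if odd n then s n./2 else t n./2); exists y.
  by move=> n; rewrite odd_double doubleK; apply: subset_closure; exact: tP.
rewrite (_ : (fun n => _) = s)//.
by apply/funext => n; rewrite oddS odd_double /= uphalf_double.
Qed.

Definition scheme (C : (nat -> nat) -> set X) (l : seq nat) : set (Borel X) :=
  closure [set x | exists2 s, mkseq s (size l) = l & C s x].

(** Lying in all these closures means that [(s, x)] is adherent to [C] in the product with Baire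
    space, and [C] is closed there. *)
Lemma schemeP (C : (nat -> nat) -> set X) s x : closed_rel C ->
  (forall n, scheme C (mkseq s n) x) <-> C s x.
Proof.
move=> cC; split=> [sP|Cs n]; last first.
  by apply: subset_closure; exists s => //; rewrite size_mkseq.
apply: cC => n U xU; have [z [[s' ss' Cz] Uz]] := sP n U xU.
exists s', z; split=> // i ni; move: ss'; rewrite size_mkseq.
by move=> /(congr1 (nth 0%N ^~ i)); rewrite !nth_mkseq.
Qed.

(** The projection is a Souslin set, so almost every point has a measurable branch [f x]. Its even
    coordinates confine the selected point [g x] to shrinking nets, which makes [g] measurable
    too. *)
Theorem measurable_selection (P : probability (Borel X) R)
    (B : set (Borel X * Borel Y)) : measurable B ->
  exists (A C : set (Borel X)) (f : Borel X -> Borel Y),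
  [/\ [/\ measurable A, measurable C, A `<=` [set x | exists y, B (x, y)] &
          [set x | exists y, B (x, y)] `<=` C],
      P (C `\` A) = 0, measurable_fun A f & forall x, A x -> B (x, f x)].
Proof.
move=> /measurable_prod_analytic[K cK BK].
have cpK := closed_proj_rel cK.
have mM l : measurable (scheme (proj_rel K) l).
  by apply: closed_measurable_Borel; exact: closed_closure.
have projB : [set x | exists y, B (x, y)] = souslin (scheme (proj_rel K)).
  transitivity [set x | exists s, proj_rel K s x].
    by rewrite proj_relE BK.
  by apply/seteqP; split=> x [s] /(schemeP s x cpK); exists s.
have [A [C [f [[mA mC AM MC] CA0 mf fM]]]] := souslin_selection P mM.
have Kf x : A x -> proj_rel K (f x) x.
  by move=> Ax; apply/(schemeP _ _ cpK); exact: fM.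
have /choice[g gP] : forall x, exists y, A x ->
    (forall n, net n (f x n.*2) y) /\ K (fun n => f x n.*2.+1) (x, y).
  move=> x; have [/Kf[y ny Ky]|nAx] := pselect (A x); last by exists point.
  by exists y.
exists A, C, g; rewrite projB; split=> //; last first.
  by move=> x /gP[_ Kx]; rewrite BK; eexists; exact: Kx.
(* For closed [F], [g x] lies in [F] exactly when every net prescribed by [f x] meets [F], a
   condition on countably many measurable coordinates. *)
have mgF (F : set Y) : closed F -> measurable (A `&` g @^-1` F).
  move=> cF; rewrite (_ : _ `&` _ = A `&` \bigcap_n
      \bigcup_(k in [set k | net n k `&` F !=set0]) [set x | A x /\ f x n.*2 = k]).
    apply: measurableI => //; apply: bigcapT_measurable => n.
    by apply: bigcup_measurable => k _; exact: mf.
  apply/seteqP; split=> x [Ax]; have [ng _] := gP x Ax.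
    move=> Fg; split=> // n _; exists (f x n.*2) => //=; exists (g x); split=> //.
  move=> H; split=> //; apply: cF => U /nbhs_ballP[r /= r0 rU].
  have r40 : (0 < r / 4)%R by rewrite divr_gt0.
  have [n _ /(_ _ (leqnn _)) /= nr] := lt_e r40.
  have [k [z [/= nz Fz]] [_ kE]] := H n I.
  exists z; split=> //; apply: rU.
  (* Both [g x] and [z] lie in the same closed ball, hence within [e n + e n] of its centre. *)
  apply: (@le_ball _ _ _ ((e n + e n) + (e n + e n))); first by lra.
  apply: (@ball_triangle _ _ (q (f x n.*2))).
    exact/ball_sym/(closure_ball_sub (e0 n))/ng.
  by apply: (closure_ball_sub (e0 n)); rewrite kE.
apply: (@measurability _ _ (Borel X) (Borel Y) A g (@open Y)) => // _ [U oU <-].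
have -> : A `&` g @^-1` U = A `\` (A `&` g @^-1` (~` U)).
  by rewrite setDIr setDv set0U preimage_setC setDE setCK.
by apply: measurableD => //; apply: mgF; rewrite closedC.
Qed.

End projection.

Lemma polish_dense_seq (R : realType) (X : completePseudoMetricType R) :
  @polish R X ->
  exists q : nat -> X, forall x (e : R), (0 < e)%R -> exists n, ball (q n) e x.
Proof.
move=> [_ [S [/countable_injP[f finj] Sdense]]].
(* Indices outside the range of [f] yield the default [point], which cannot harm density. *)
exists (fun n => xget point [set x | S x /\ f x = n]) => x e e0.
have : closure S x by rewrite Sdense.
move=> /(_ _ (nbhsx_ballx x e e0))[y [Sy xy]]; exists (f y).
have [Sz fzy] := @xgetPex _ point [set z | S z /\ f z = f y] (ex_intro _ y (conj Sy erefl)).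
by apply: ball_sym; rewrite (finj _ _ _ _ fzy)// inE.
Qed.

(** * Borel measurability of lower semicontinuous functions on a product *)

Section lower_semicontinuous_prod.
Context {R : realType} {X Y : pseudoPMetricType R}.
Variables (p : nat -> X) (q : nat -> Y).
Hypothesis p_dense : forall x (e : R), (0 < e)%R -> exists n, ball (p n) e x.
Hypothesis q_dense : forall y (e : R), (0 < e)%R -> exists n, ball (q n) e y.

(** Separability makes an open set a countable union of open boxes, so the Borel sets of the product
    topology belong to the product sigma-algebra. *)
Lemma open_measurable_prod (W : set (X * Y)) :
  open W -> measurable (W : set (Borel X * Borel Y)).
Proof.
move=> oW; pose e n : R := (n.+1%:R^-1)%R.
pose box (t : nat * nat * nat) : set (Borel X * Borel Y) :=
  ((ball (p t.1.1) (e t.2))° : set (Borel X)) `*`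
  ((ball (q t.1.2) (e t.2))° : set (Borel Y)).
rewrite (_ : W = \bigcup_(t in [set t | box t `<=` W]) box t).
  rewrite bigcup_mkcond; apply: countable_bigcupT_measurable => // t.
  by case: ifPn => // _; apply: measurableX; apply: sub_sigma_algebra; exact: open_interior.
apply/seteqP; split=> [[x y] Wxy|z [t tW /tW]//].
have /nbhs_ballP[r /= r0 rW] : nbhs (x, y) W by exact: open_nbhs_nbhs.
have [n _ /(_ _ (leqnn _)) /= nr] :=
  near_infty_natSinv_lt (PosNum (divr_gt0 r0 (ltr0Sn R 1))).
(* Half the radius places [x] and [y] in the interiors of the balls that form the box. *)
have e20 : (0 < e n / 2)%R by rewrite divr_gt0// invr_gt0.
have [i px] := p_dense x e20; have [j qy] := q_dense y e20.
have lte : (e n / 2 <= e n)%R by lra.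
have er : (e n + e n <= r)%R by have : (e n < r / 2)%R by []; lra.
exists (i, j, n) => /=.
  move=> [x' y'] [/= /interior_subset xx' /interior_subset yy'].
  by apply: rW; split; apply: (le_ball er);
    [apply: ball_triangle xx'|apply: ball_triangle yy'];
    apply/ball_sym/(le_ball lte).
split=> /=; apply/nbhs_ballP; exists (e n / 2)%R => //= w.
  by move=> /(ball_triangle px); rewrite -splitr.
by move=> /(ball_triangle qy); rewrite -splitr.
Qed.

Lemma lower_semicontinuous_measurable_prod (f : X * Y -> \bar R) :
  lower_semicontinuous f ->
  measurable_fun setT (f : (Borel X * Borel Y)%type -> \bar R).
Proof.
move=> /lower_semicontinuousP lf.
apply: (@measurability _ _ (Borel X * Borel Y)%type (\bar R) setT f _
  (ErealGenOInfty.measurableE R)) => _ [_ [a ->] <-].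
rewrite setTI preimage_itvoy; apply: open_measurable_prod; exact: lf.
Qed.

End lower_semicontinuous_prod.

(** * Integrals *)

Lemma measurable_fun_if_id d (T : measurableType d) (A : set T) (s : T -> T) :
  measurable A -> measurable_fun A s ->
  measurable_fun setT (fun x => if x \in A then s x else x).
Proof.
move=> mA ms _ U mU; rewrite setTI.
rewrite (_ : _ @^-1` U = (A `&` s @^-1` U) `|` (U `\` A)).
  by apply: measurableU; [exact: ms|exact: measurableD].
apply/seteqP; split=> x /=.
  by case: ifPn => [/set_mem Ax|/negP xA] Ux; [left|right; split=> // /mem_set].
by move=> [[Ax Ux]|[Ux nAx]]; [rewrite mem_set|rewrite memNset].
Qed.

Section integral_toolkit.
Context {R : realType}.

(** Positive and negative parts are transported separately. Asking only that [nu] agree with the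
    image on measurable sets serves both marginals of couplings and completions. *)
Lemma integral_image d1 d2 (T1 : measurableType d1) (T2 : measurableType d2)
    (mu : {measure set T1 -> \bar R}) (nu : {measure set T2 -> \bar R})
    (phi : T1 -> T2) (f : T2 -> \bar R) :
  measurable_fun setT phi ->
  (forall A, measurable A -> nu A = mu (phi @^-1` A)) ->
  measurable_fun setT f ->
  \int[nu]_y f y = \int[mu]_x f (phi x).
Proof.
move=> mphi nuE mf.
have ge0 (g : T2 -> \bar R) : measurable_fun setT g -> (forall y, 0 <= g y) ->
    \int[nu]_y g y = \int[mu]_x g (phi x).
  move=> mg g0.
  rewrite -[RHS](@ge0_integral_pushforward _ _ _ _ R phi mphi mu setT g) //.
  by apply: eq_measure_integral => A mA _; exact: nuE.
rewrite integralE [RHS]integralE; congr (_ - _).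
  rewrite (ge0 _ (measurable_funepos mf) (funepos_ge0 f)).
  by apply: eq_integral => x _; rewrite !funeposE.
rewrite (ge0 _ (measurable_funeneg mf) (funeneg_ge0 f)).
by apply: eq_integral => x _; rewrite !funenegE.
Qed.

Lemma integral_cst_prob d (T : measurableType d) (Q : probability T R) (r : \bar R) :
  \int[Q]_x cst r x = r.
Proof.
by rewrite integral_cst// -[RHS]mule1; congr (_ * _); exact: probability_setT.
Qed.

Context d (T : measurableType d) (mu : {measure set T -> \bar R}).
Implicit Types f g : T -> \bar R.

(** Comparing positive and negative parts is enough, thanks to the convention [+oo - +oo = -oo]. *)
Lemma ae_le_integralT f g : measurable_fun setT f -> measurable_fun setT g ->
  (\forall x \ae mu, f x <= g x) -> \int[mu]_x f x <= \int[mu]_x g x.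
Proof.
move=> mf mg fg; rewrite integralE [leRHS]integralE; apply: leeB.
  apply: ae_ge0_le_integral => //; [exact: measurable_funepos|exact: measurable_funepos|].
  apply: filterS fg => x fgx _; rewrite !funeposE.
  by rewrite ge_max !le_max fgx lexx/= orbT.
apply: ae_ge0_le_integral => //; [exact: measurable_funeneg|exact: measurable_funeneg|].
apply: filterS fg => x fgx _; rewrite !funenegE.
by rewrite ge_max !le_max leeN2 fgx lexx/= orbT.
Qed.

(** Here [f] may fail to be integrable. The identity [(f + g)^+ + f^- = (f + g)^- + f^+ + g] is
    integrated and rearranged; the bounds [(f + g)^- <= f^- <= (f + g)^- + g] make both negative
    parts infinite together, and then both sides are [-oo]. *)
Lemma integralD_ge0 f g : measurable_fun setT f -> measurable_fun setT g ->
  (forall x, 0 <= g x) -> \int[mu]_x g x < +oo ->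
  \int[mu]_x (f x + g x) = \int[mu]_x f x + \int[mu]_x g x.
Proof.
move=> mf mg g0 goo.
have gfin : \forall x \ae mu, g x \is a fin_num.
  have /integrable_ae : mu.-integrable setT g.
    apply/integrableP; split=> //.
    by under eq_integral do rewrite gee0_abs//.
  by move=> /(_ measurableT); apply: filterS => x; exact.
have mfg : measurable_fun setT (f \+ g) by exact: emeasurable_funD.
have mfgp : measurable_fun setT (f \+ g)^\+ by exact: measurable_funepos.
have mfgn : measurable_fun setT (f \+ g)^\- by exact: measurable_funeneg.
have mfp : measurable_fun setT f^\+ by exact: measurable_funepos.
have mfn : measurable_fun setT f^\- by exact: measurable_funeneg.
rewrite integralE [X in _ = X + _]integralE.
set a := integral _ _ (_^\+); set b := integral _ _ (_^\-).
set p := integral _ _ (_^\+); set m := integral _ _ (_^\-).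
set G := integral _ _ _ in goo *.
have a0 : 0 <= a by apply: integral_ge0.
have b0 : 0 <= b by apply: integral_ge0.
have p0 : 0 <= p by apply: integral_ge0.
have m0 : 0 <= m by apply: integral_ge0.
have G0 : 0 <= G by apply: integral_ge0.
have split_fg : a + m = b + (p + G).
  rewrite /a /m /b /p /G -!ge0_integralD//; last 2 first.
  - by move=> x _; exact: adde_ge0.
  - exact: emeasurable_funD.
  apply: ge0_ae_eq_integral => //.
  - exact: emeasurable_funD.
  - by apply: emeasurable_funD => //; exact: emeasurable_funD.
  - by move=> x _; exact: adde_ge0.
  - by move=> x _; apply: adde_ge0 => //; exact: adde_ge0.
  - apply: filterS gfin => x + _; rewrite !funeposE !funenegE /=.
    move: (g0 x); case: (g x) => [s| |]//; rewrite lee_fin => s0 _.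
    case: (f x) => [t| |]//=.
      rewrite -EFinD -!EFin_max -!EFinD; congr (_%:E).
      by rewrite /Num.max; repeat case: ifPn; rewrite -?leNgt => *; lra.
    by rewrite !maxye// ?maxNye.
have mbG : m <= b + G.
  rewrite /m /b /G -ge0_integralD//; apply: ae_ge0_le_integral => //.
  - by move=> x _; exact: adde_ge0.
  - exact: emeasurable_funD.
  - apply: filterS gfin => x + _; rewrite !funenegE /=.
    move: (g0 x); case: (g x) => [s| |]//; rewrite lee_fin => s0 _.
    case: (f x) => [t| |] /=.
    + rewrite -!EFin_max -!EFinD lee_fin.
      by rewrite /Num.max; repeat case: ifPn; rewrite -?leNgt => *; lra.
    + by rewrite maxNye add0e lee_fin.
    + by rewrite maxye// addye.
have bm : b <= m.
  rewrite /m /b; apply: ge0_le_integral => // x _; rewrite !funenegE /=.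
  rewrite ge_max !le_max lexx orbT andbT leeN2.
  by apply/orP; left; exact: leeDl.
clearbody a b p m G.
move: G G0 goo split_fg mbG bm => [G| |]// G0 _.
move: m m0 => [m| |]// m0; last first.
  by move: b b0 => [b| |]// _ _ _ _; case: a a0 => [a| |]//; case: p p0 => [p| |].
move: b b0 => [b| |]// b0.
move: p p0 => [p| |]// p0; case: a a0 => [a| |]// a0 [] H _ _; congr (_%:E); lra.
Qed.

End integral_toolkit.

(** * Suprema over sections *)

Lemma ereal_rat_between (R : realType) (x y : \bar R) :
  x < y -> exists r : rat, x < (ratr r)%:E < y.
Proof.
have between (a b : R) : (a < b)%R -> exists r : rat, (a < ratr r < b)%R.
  by move=> /rat_in_itvoo[r]; rewrite in_itv; exists r.
move: x y => [a| |] [b| |]//=.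
- by rewrite lte_fin => /between[r]; exists r; rewrite !lte_fin.
- move=> _; have [r /andP[ar _]] : exists r : rat, (a < ratr r < a + 1)%R.
    by apply: between; rewrite ltrDl.
  by exists r; rewrite lte_fin ar ltry.
- move=> _; have [r /andP[_ rb]] : exists r : rat, (b - 1 < ratr r < b)%R.
    by apply: between; rewrite ltrBlDr ltrDl.
  by exists r; rewrite lte_fin rb ltNyr.
- by move=> _; exists 0%R; rewrite ltNyr ltry.
Qed.

Section sup_section.
Context {R : realType} {X : pseudoPMetricType R} {Y : completePseudoMetricType R}.
Variable q : nat -> Y.
Hypothesis q_dense : forall y (e : R), (0 < e)%R -> exists n, ball (q n) e y.

(** For rational [r], the set where the supremum exceeds [r] is a projection, squeezed between Borel
    sets [A n] and [C n] with null difference. The version [f] is the supremum of those [r n] with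
    [x] in [A n]. *)
Theorem sup_section_version (P : probability (Borel X) R)
    (h : Borel X * Borel Y -> \bar R) : measurable_fun setT h ->
  exists (f : Borel X -> \bar R) (N : set (Borel X)),
  [/\ measurable_fun setT f, measurable N, P N = 0,
      forall x, f x <= ereal_sup [set h (x, y) | y in [set: Y]] &
      forall x, ~ N x -> f x = ereal_sup [set h (x, y) | y in [set: Y]]].
Proof.
move=> mh; pose S x := ereal_sup [set h (x, y) | y in [set: Y]].
pose r n : R := if unpickle n is Some a then ratr a else 0%R.
pose B n : set (Borel X * Borel Y) := [set z | (r n)%:E < h z].
have mB n : measurable (B n).
  by rewrite -[B n]setTI; exact: emeasurable_fun_o_infty.
have BS n x : (exists y, B n (x, y)) <-> (r n)%:E < S x.
  split=> [[y Bxy]|/ereal_sup_gt[_ [y _ <-] ?]]; last by exists y.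
  by apply: (lt_le_trans Bxy); apply: ereal_sup_ubound; exists y.
have /choice[A AP] : forall n, exists A : set (Borel X), exists C : set (Borel X),
  [/\ measurable A, measurable C, P (C `\` A) = 0,
      forall x, A x -> (r n)%:E < S x & forall x, (r n)%:E < S x -> C x].
  move=> n; have [A [C [_ [[mA mC AB BC] CA0 _ _]]]] :=
    measurable_selection q_dense P (mB n).
  by exists A, C; split=> // x; [move=> /AB/BS|move=> /BS/BC].
have [C CP] := choice AP.
have mA n : measurable (A n) by have [] := CP n.
pose u n x : \bar R := if x \in A n then (r n)%:E else -oo.
have mu n : measurable_fun setT (u n).
  apply: measurable_fun_ifT => //.
  apply: (measurable_fun_bool true); rewrite setTI.
  rewrite (_ : _ @^-1` _ = A n)//.
  by apply/seteqP; split=> x /=; [move=> /set_mem|move=> /mem_set].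
(* [esups _ 0] is the supremum of the whole sequence. *)
have usup x n : u n x <= esups (u ^~ x) 0%N by apply: ereal_sup_ubound; exists n.
have fS x : esups (u ^~ x) 0%N <= S x.
  apply: ge_ereal_sup => _ [n _ <-]; rewrite /u.
  case: ifPn => [/set_mem Ax|_]; last exact: leNye.
  by apply/ltW; have [_ _ _ + _] := CP n; exact.
exists (fun x => esups (u ^~ x) 0%N), (\bigcup_n (C n `\` A n)); split=> //.
- exact: measurable_fun_esups.
- by apply: bigcup_measurable => n _; have [? ? _ _ _] := CP n; exact: measurableD.
- apply: measure_negligible.
    by apply: bigcup_measurable => n _; have [? ? _ _ _] := CP n; exact: measurableD.
  apply: negligible_bigcup => n; have [? ? ? _ _] := CP n.
  by apply/negligibleP => //; exact: measurableD.
- move=> x Nx; apply/eqP; rewrite eq_le fS /= leNgt; apply/negP.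
  move=> /ereal_rat_between[a]; rewrite (_ : ratr a = r (pickle a)); last first.
    by rewrite /r pickleK.
  move: (pickle a) => n /andP[uxr rS].
  have Ax : A n x.
    apply: contrapT => nAx; apply: Nx; exists n => //; split=> //.
    by have [_ _ _ _] := CP n; exact.
  have := usup x n; rewrite /u mem_set// => /le_lt_trans /(_ uxr).
  by rewrite ltxx.
Qed.

End sup_section.

(** * Completed measures and universal measurability *)

Section completion.
Context {R : realType} {X : completePseudoMetricType R}.

Lemma universally_measurable_version (g : X -> \bar R) :
  (forall P : @pmeasure R X, exists (f : Borel X -> \bar R) (N : set (Borel X)),
    [/\ measurable_fun setT f, measurable N, P N = 0 &
        forall x, ~ N x -> f x = g x]) ->
  universally_measurable g.
Proof.
move=> gP P B mB; have [f [N [mf mN PN fg]]] := gP P.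
exists (f @^-1` B `\` N); first by apply: measurableD => //; rewrite -[_ @^-1` _]setTI; exact: mf.
exists (g @^-1` B `&` N); first by exists N; split=> // x [].
apply/seteqP; split=> x /=.
  by move=> [[/[swap] /fg ->]|[]].
by move=> Bgx; have [Nx|Nx] := pselect (N x); [right|left; rewrite /= fg].
Qed.

Variable Q : @pmeasure R X.

Let cT := caratheodory_type (mu_ext Q).
Let cQ := @completed_measure_extension _ (Borel X) R Q.

Let cara_measurable (A : set (Borel X)) : measurable A -> measurable (A : set cT).
Proof. exact: caratheodory_measurable_mu_ext. Qed.

Let cara_measurable_fun (f : Borel X -> \bar R) :
  measurable_fun setT f -> measurable_fun setT (f : cT -> \bar R).
Proof.
move=> mf _ B mB; rewrite setTI; apply: cara_measurable.
by rewrite -[_ @^-1` _]setTI; exact: mf.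
Qed.

(** The identity is measurable from the completed space to the Borel space and maps the completion
    of [Q] to [Q]. *)
Lemma cexpectE (f : Borel X -> \bar R) :
  measurable_fun setT f -> cexpect Q f = \int[Q]_x f x.
Proof.
move=> mf.
have mid : measurable_fun setT (id : cT -> Borel X).
  by move=> _ A mA; rewrite setTI; exact: cara_measurable.
have QE (A : set (Borel X)) : measurable A -> Q A = cQ A.
  by move=> mA; rewrite -[LHS]measurable_mu_extE.
exact/esym/(@integral_image R _ _ cT (Borel X) cQ Q id f mid QE mf).
Qed.

Section version.
Context (g : X -> \bar R) (f : Borel X -> \bar R) (N : set (Borel X)).
Hypotheses (mf : measurable_fun setT f) (mN : measurable N) (QN : Q N = 0).
Hypothesis fg : forall x, ~ N x -> f x = g x.

Let fg_ae : ae_eq cQ setT (f : cT -> \bar R) g.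
Proof.
exists N; split.
- exact: cara_measurable.
- by rewrite -QN; exact: measurable_mu_extE.
- by move=> x /= nfg; apply: contrapT => /fg fgx; apply: nfg.
Qed.

Lemma version_measurable_completed : measurable_fun setT (g : cT -> \bar R).
Proof.
apply: ae_measurable_fun fg_ae (cara_measurable_fun mf).
exact: measure_is_complete_caratheodory.
Qed.

Lemma cexpect_version : cexpect Q g = \int[Q]_x f x.
Proof.
rewrite -cexpectE// /cexpect; symmetry.
exact: (@ae_eq_integral _ cT _ cQ setT g f measurableT (cara_measurable_fun mf)
  version_measurable_completed fg_ae).
Qed.

End version.

End completion.

(** * Duality *)

Section gain.
Context {R : realType}.
Variable lam : R.
Hypothesis lam0 : (0 < lam)%R.
Implicit Types l k s : \bar R.

Lemma gain_le l k s : k \is a fin_num ->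
  (l * (lam^-1)%:E - k <= s) = (l <= lam%:E * s + lam%:E * k).
Proof.
move=> kfin; rewrite leeBlDr// muleC lee_pdivrMl// muleDr//.
exact: fin_num_adde_defl.
Qed.

(** An infinite [k] forces [s = -oo], and the left side is then [-oo] because [-oo + +oo = -oo]. *)
Lemma le_gain l k s : l < +oo -> 0 <= k ->
  s <= l * (lam^-1)%:E - k -> lam%:E * s + lam%:E * k <= l.
Proof.
move=> loo; move: k => [k| |]// _.
  rewrite leeBrDr// muleC lee_pdivlMl// muleDr//.
  exact: fin_num_adde_defl.
by rewrite addeNy leeNy_eq => /eqP ->; rewrite gt0_muleNy ?lte_fin// addNye leNye.
Qed.

End gain.

Section duality.
Context {R : realType} {X : completePseudoMetricType R}.
Variables (P : @pmeasure R X) (D : @pmeasure R X -> @pmeasure R X -> \bar R).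
Variables (c : X -> X -> \bar R) (lam : R).
Hypothesis polishX : @polish R X.
Hypothesis D_ge0 : forall mu nu, 0 <= D mu nu.
Hypothesis costc : cost_function c.
Hypothesis lam0 : (0 < lam)%R.
Implicit Types (L : X -> \bar R) (Q : @pmeasure R X).

Let cprod (z : Borel X * Borel X) := c z.1 z.2.

Lemma cost_ge0 x y : 0 <= c x y. Proof. by case: costc. Qed.

Lemma measurable_cost : measurable_fun setT cprod.
Proof.
have [q q_dense] := polish_dense_seq polishX.
exact: (lower_semicontinuous_measurable_prod q_dense q_dense costc.1).
Qed.

Lemma measurable_gain L : measurable_fun setT (L : Borel X -> \bar R) ->
  measurable_fun setT
    (fun z : Borel X * Borel X => L z.2 * (lam^-1)%:E - c z.1 z.2).
Proof.
move=> mL; apply: emeasurable_funB; last exact: measurable_cost.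
apply: emeasurable_funM => //.
by apply: measurableT_comp => //; exact: measurable_snd.
Qed.

Lemma Lc_version L Q : measurable_fun setT (L : Borel X -> \bar R) ->
  exists (f : Borel X -> \bar R) (N : set (Borel X)),
  [/\ measurable_fun setT f, measurable N, Q N = 0, forall x, f x <= Lc L c lam x &
      forall x, ~ N x -> f x = Lc L c lam x].
Proof.
move=> mL; have [q q_dense] := polish_dense_seq polishX.
by have [f [N ?]] := sup_section_version q_dense Q (measurable_gain mL); exists f, N.
Qed.

Lemma Lc_universally_measurable L : measurable_fun setT (L : Borel X -> \bar R) ->
  universally_measurable (Lc L c lam).
Proof.
move=> mL; apply: universally_measurable_version => Q.
by have [f [N [mf mN QN _ fN]]] := Lc_version Q mL; exists f, N.
Qed.

Lemma ot_cost_ge0 mu nu : 0 <= ot_cost c mu nu.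
Proof.
apply: le_ereal_inf_tmp => _ [pi _ <-].
by apply: integral_ge0 => z _; exact: cost_ge0.
Qed.

Lemma Dc_ge0 mu nu : 0 <= Dc D c mu nu.
Proof.
apply: le_ereal_inf_tmp => _ [eta _ <-].
by apply: adde_ge0 => //; exact: ot_cost_ge0.
Qed.

(** The pointwise bound [L y <= lam * f x + lam * c x y] holds where the cost is finite and [x]
    avoids the null set of the version [f], hence almost everywhere for [pi]. *)
Lemma coupling_integral_le L Q eta (pi : probability (Borel X * Borel X)%type R) :
  measurable_fun setT (L : Borel X -> \bar R) ->
  coupling eta Q pi -> \int[pi]_z c z.1 z.2 < +oo ->
  \int[Q]_x L x <=
    cexpect eta (fun x => lam%:E * Lc L c lam x) + lam%:E * \int[pi]_z c z.1 z.2.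
Proof.
move=> mL [pi1 pi2] coo; have [f [N [mf mN etaN _ fN]]] := Lc_version eta mL.
have mlf : measurable_fun setT (fun x => lam%:E * f x) by exact: measurable_funeM.
have mlc : measurable_fun setT (fun z => lam%:E * cprod z).
  by apply: measurable_funeM; exact: measurable_cost.
have mf1 : measurable_fun setT (fun z : Borel X * Borel X => lam%:E * f z.1).
  by apply: (measurableT_comp mlf); exact: measurable_fst.
have lam0E : 0 <= lam%:E by rewrite lee_fin ltW.
rewrite (cexpect_version (f := fun x => lam%:E * f x) mlf mN etaN); last first.
  by move=> x /fN ->.
rewrite (@integral_image R _ _ _ _ pi Q snd)//; last by move=> A /pi2.
rewrite (@integral_image R _ _ _ _ pi eta fst _ _ _ mlf)//; last by move=> A /pi1.
have intlc : \int[pi]_z (lam%:E * cprod z) = lam%:E * \int[pi]_z cprod z.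
  by rewrite ge0_integralZl//; [exact: measurable_cost|move=> z _; exact: cost_ge0].
rewrite -intlc -integralD_ge0//; last 2 first.
- by move=> z; apply: mule_ge0 => //; exact: cost_ge0.
- by rewrite intlc lte_mul_pinfty.
apply: ae_le_integralT.
- by apply: measurableT_comp => //; exact: measurable_snd.
- exact: emeasurable_funD.
have : \forall z \ae pi, cprod z \is a fin_num.
  have /integrable_ae : pi.-integrable setT cprod.
    apply/integrableP; split; first exact: measurable_cost.
    by under eq_integral do rewrite gee0_abs ?cost_ge0//.
  by move=> /(_ measurableT); apply: filterS => z; exact.
have : \forall z \ae pi, ~ N z.1.
  exists (fst @^-1` N); split=> [| |z /= /contrapT//].
  - by rewrite -[_ @^-1` _]setTI; exact: measurable_fst.
  - by rewrite pi1.
apply: filterS2 => z /fN fz cfin; rewrite -gain_le// fz.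
by apply: ereal_sup_ubound; exists z.2.
Qed.

Lemma integral_sub_Dc_le L Q r : measurable_fun setT (L : Borel X -> \bar R) ->
  (forall eta, D eta P < +oo ->
     cexpect eta (fun x => lam%:E * Lc L c lam x) - lam%:E * D eta P <= r) ->
  Dc D c Q P < +oo -> \int[Q]_x L x - lam%:E * Dc D c Q P <= r.
Proof.
move=> mL rP Dcoo.
have Dcfin : Dc D c Q P \is a fin_num by rewrite ge0_fin_numE// Dc_ge0.
rewrite leeBlDr ?fin_numM//; apply/lee_addgt0Pr => e e0.
(* The error [e / lam] is shared equally between a nearly optimal [eta] and a nearly optimal
   coupling. *)
have d0 : (0 < e / lam / 2)%R by rewrite !divr_gt0.
have [_ [eta _ <-] etalt] := lb_ereal_inf_adherent d0 Dcfin.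
have : D eta P + ot_cost c eta Q < +oo.
  by apply: lt_trans etalt _; rewrite -ge0_fin_numE ?fin_numD ?Dcfin// adde_ge0 ?Dc_ge0// lee_fin ltW.
have otge0 := ot_cost_ge0 eta Q.
have Dge0 := D_ge0 eta P.
move=> sumoo.
have Dfin : D eta P \is a fin_num.
  by rewrite ge0_fin_numE//; apply: le_lt_trans sumoo; exact: leeDl.
have otfin : ot_cost c eta Q \is a fin_num.
  by rewrite ge0_fin_numE//; apply: le_lt_trans sumoo; exact: leeDr.
have [_ [pi piP <-] pilt] := lb_ereal_inf_adherent d0 otfin.
have cge0 : 0 <= \int[pi]_z c z.1 z.2 by apply: integral_ge0 => z _; exact: cost_ge0.
have coo : \int[pi]_z c z.1 z.2 < +oo.
  by apply: lt_trans pilt _; rewrite -ge0_fin_numE ?fin_numD ?otfin// adde_ge0// lee_fin ltW.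
have cfin : \int[pi]_z c z.1 z.2 \is a fin_num by rewrite ge0_fin_numE.
apply: (le_trans (coupling_integral_le mL piP coo)).
have := rP eta; rewrite -ge0_fin_numE// => /(_ Dfin); rewrite leeBlDr ?fin_numM// => H.
apply: (le_trans (leeD2r _ H)); rewrite -!addeA leeD2l//.
move: etalt pilt; rewrite -/(Dc D c Q P) -/(ot_cost c eta Q).
rewrite -(fineK Dcfin) -(fineK Dfin) -(fineK otfin) -(fineK cfin).
rewrite -!EFinD !lte_fin lee_fin => h1 h2.
have -> : e = (lam * (e / lam / 2 + e / lam / 2))%R.
  by rewrite -splitr mulrCA divff ?gt_eqF// mulr1.
by rewrite -!mulrDr ler_pM2l//; lra.
Qed.

(** The image [nu] of [Q] under [y] is coupled to [Q] by [x |-> (x, y x)], so [Dc D c nu P] is at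
    most [D Q P] plus the transport cost. This is finite, and the bound [r] applies to [nu]. *)
Lemma transport_integral_le L Q (y : Borel X -> Borel X) (r : \bar R) :
  measurable_fun setT (L : Borel X -> \bar R) -> measurable_fun setT y ->
  (forall nu, Dc D c nu P < +oo -> \int[nu]_x L x - lam%:E * Dc D c nu P <= r) ->
  D Q P < +oo -> \int[Q]_x c x (y x) < +oo ->
  \int[Q]_x L (y x) <= r + lam%:E * D Q P + lam%:E * \int[Q]_x c x (y x).
Proof.
move=> mL my rP Doo coo.
pose py (x : Borel X) : Borel X * Borel X := (x, y x).
have mpy : measurable_fun setT py by exact: measurable_fun_pair.
pose nu : @pmeasure R X := distribution Q (mfun_Sub (mem_set my)).
pose pi : probability (Borel X * Borel X)%type R :=
  distribution Q (mfun_Sub (mem_set mpy)).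
have piP : coupling Q nu pi by split.
have cE : \int[pi]_z c z.1 z.2 = \int[Q]_x c x (y x).
  by rewrite (@integral_image R _ _ _ _ Q pi py)//; exact: measurable_cost.
have otle : ot_cost c Q nu <= \int[Q]_x c x (y x).
  by rewrite -cE; apply: ereal_inf_lbound; exists pi.
have Dcle : Dc D c nu P <= D Q P + \int[Q]_x c x (y x).
  apply: (@le_trans _ _ (D Q P + ot_cost c Q nu)); last exact: leeD2l.
  by apply: ereal_inf_lbound; exists Q.
have Dcoo : Dc D c nu P < +oo by apply: le_lt_trans Dcle _; exact: lte_add_pinfty.
have Dc0 : 0 <= Dc D c nu P by exact: Dc_ge0.
have := rP nu Dcoo; rewrite (@integral_image R _ _ _ _ Q nu y)//.
rewrite leeBlDr; last by rewrite fin_numM// ge0_fin_numE.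
move=> /le_trans; apply; rewrite -addeA leeD2l// -muleDr//.
  by rewrite lee_pmul2l.
by apply: ge0_adde_def; rewrite inE//; apply: integral_ge0 => x _; exact: cost_ge0.
Qed.

(** The upper bound on [L] bounds [Lc] above, so the expectation is [-oo] or the integrand is
    integrable. In the second case the cost of a nearly optimal Borel selection is integrable too,
    and transport along it gives the bound up to [e]. *)
Lemma cexpect_le_bounded L Q (r : \bar R) (M : R) :
  (forall x, c x x = 0) ->
  measurable_fun setT (L : Borel X -> \bar R) -> (forall x, L x <= M%:E) ->
  (forall nu, Dc D c nu P < +oo -> \int[nu]_x L x - lam%:E * Dc D c nu P <= r) ->
  D Q P < +oo ->
  cexpect Q (fun x => lam%:E * Lc L c lam x) <= r + lam%:E * D Q P.
Proof.
move=> cxx mL LM rP Doo.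
have [f [N [mf mN QN fLc fN]]] := Lc_version Q mL.
have mlf : measurable_fun setT (fun x => lam%:E * f x) by exact: measurable_funeM.
rewrite (cexpect_version (f := fun x => lam%:E * f x) mlf mN QN); last first.
  by move=> x /fN ->.
have [->|lfNy] := eqVneq (\int[Q]_x (lam%:E * f x)) -oo; first exact: leNye.
have c0 := cost_ge0.
have lam0E : 0 <= lam%:E by rewrite lee_fin ltW.
have loo x : L x < +oo by apply: le_lt_trans (LM x) _; rewrite ltry.
have LcM x : Lc L c lam x <= (M / lam)%:E.
  apply: ge_ereal_sup => _ [y _ <-].
  apply: (@le_trans _ _ (L y * (lam^-1)%:E)).
    by rewrite -[leRHS]adde0 leeD2l// oppe_le0.
  by rewrite EFinM lee_pmul2r// lte_fin invr_gt0.
have foo x : f x < +oo.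
  by apply: le_lt_trans (fLc x) (le_lt_trans (LcM x) _); rewrite ltry.
have lfM x : lam%:E * f x <= M%:E.
  by rewrite -lee_pdivlMl// -EFinM mulrC; apply: (le_trans (fLc x)).
have intp : \int[Q]_x (fun x => lam%:E * f x)^\+ x < +oo.
  apply: (@le_lt_trans _ _ (\int[Q]_x (cst `|M|%:E) x)); last first.
    by rewrite integral_cst_prob ltry.
  apply: ge0_le_integral => //; first exact: measurable_funepos.
  move=> x _; rewrite funeposE ge_max /= lee_fin normr_ge0 andbT.
  by apply: le_trans (lfM x) _; rewrite lee_fin ler_norm.
have intn : \int[Q]_x (fun x => lam%:E * f x)^\- x < +oo.
  rewrite ltNge leye_eq; apply: contra lfNy => /eqP h.
  by rewrite integralE h addeNy.
have intabs : \int[Q]_x `|lam%:E * f x| < +oo.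
  under eq_integral do rewrite -/(comp abse (fun x => lam%:E * f x) _) fune_abse.
  rewrite ge0_integralD//; [exact: lte_add_pinfty|exact: measurable_funepos|].
  exact: measurable_funeneg.
apply/lee_addgt0Pr => e e0.
pose d := (e / lam)%R.
have d0 : (0 < d)%R by rewrite divr_gt0.
(* Near-optimality is measured against the Borel version [f], so that [B] is Borel. *)
pose B : set (Borel X * Borel X) :=
  [set z | f z.1 - d%:E <= L z.2 * (lam^-1)%:E - c z.1 z.2].
have mB : measurable B.
  rewrite -[B]setTI; apply: measurable_lee => //; last exact: measurable_gain.
  apply: emeasurable_funB => //; apply: (measurableT_comp mf); exact: measurable_fst.
have [q q_dense] := polish_dense_seq polishX.
have [A [C [s [[mA mC AB BC] CA0 ms sB]]]] := measurable_selection q_dense Q mB.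
have CN x : ~ N x -> C x.
  move=> Nx; apply: BC; case E : (f x) => [a| |]; last 2 first.
  - by have := foo x; rewrite E ltxx.
  - by exists x; rewrite /B /= E leNye.
  - have : (a - d)%:E < Lc L c lam x by rewrite -fN// E lte_fin ltrBlDr ltrDl.
    move=> /ereal_sup_gt[_ [y _ <-]] /ltW aL.
    by exists y; rewrite /B /= E.
(* Off [A] points stay put, at no cost since [c x x = 0]. *)
pose y (x : Borel X) : Borel X := if x \in A then s x else x.
have my : measurable_fun setT y by exact: measurable_fun_if_id.
pose cy (x : Borel X) := c x (y x).
have mcy : measurable_fun setT cy.
  have mpy : measurable_fun setT (fun x : Borel X => (x, y x)) by exact: measurable_fun_pair.
  exact: (measurableT_comp measurable_cost mpy).
have lamd : (lam * d)%R = e by rewrite /d mulrCA divff ?gt_eqF// mulr1.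
have ucy x : A x -> lam%:E * (f x - d%:E) + lam%:E * cy x <= L (y x).
  by move=> Ax; apply: le_gain => //; rewrite /cy /y mem_set//; exact: sB.
(* Near-optimality together with [L <= M] bounds the cost by an integrable function. *)
have lcyM x : lam%:E * cy x <= `|lam%:E * f x| + (`|M| + e)%:E.
  have [Ax|nAx] := pselect (A x); last first.
    rewrite /cy /y memNset// cxx mule0 adde_ge0// lee_fin.
    by rewrite addr_ge0// ltW.
  have := le_trans (ucy x Ax) (LM _).
  have := c0 x (y x); rewrite -/(cy x).
  have := foo x; case: (f x) => [a| |]//; last first.
    by rewrite gt0_muleNy ?lte_fin//= addye// leey.
  case: (cy x) => [k| |]// _ k0.
    rewrite -!EFinD !lee_fin mulrBr lamd => h.
    have := ler_norm M; have := ler_norm (- (lam * a)); rewrite normrN => h1 h2.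
    rewrite /=; lra.
  by rewrite gt0_muley ?lte_fin// addey.
have lcyoo : \int[Q]_x (lam%:E * cy x) < +oo.
  apply: (@le_lt_trans _ _ (\int[Q]_x (`|lam%:E * f x| + cst (`|M| + e)%:E x))).
    apply: ge0_le_integral => //.
    - by move=> x _; apply: mule_ge0 => //; exact: c0.
    - exact: measurable_funeM.
    - by apply: emeasurable_funD => //; exact: measurableT_comp.
  rewrite ge0_integralD//; last 2 first.
  - exact: measurableT_comp.
  - by move=> x _; rewrite lee_fin addr_ge0// ltW.
  by rewrite integral_cst_prob lte_add_pinfty// ltry.
have lcyE : \int[Q]_x (lam%:E * cy x) = lam%:E * \int[Q]_x cy x.
  by rewrite ge0_integralZl// => x _; exact: c0.
have cyoo : \int[Q]_x cy x < +oo.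
  rewrite ltNge leye_eq; apply/negP => /eqP h.
  by move: lcyoo; rewrite lcyE h gt0_muley ?lte_fin// ltxx.
have mu' : measurable_fun setT (fun x => lam%:E * (f x - d%:E)).
  by apply: measurable_funeM; exact: emeasurable_funB.
have mLy : measurable_fun setT (fun x : Borel X => L (y x)).
  exact: (measurableT_comp mL my).
have mlcy : measurable_fun setT (fun x => lam%:E * cy x) by exact: measurable_funeM.
have lcy0 x : 0 <= lam%:E * cy x by apply: mule_ge0 => //; exact: c0.
have uLy : \int[Q]_x (lam%:E * (f x - d%:E)) + \int[Q]_x (lam%:E * cy x)
    <= \int[Q]_x L (y x).
  rewrite -integralD_ge0//; apply: ae_le_integralT => //; first exact: emeasurable_funD.
  exists (N `|` (C `\` A)); split.
  - by apply: measurableU => //; exact: measurableD.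
  - apply: measure_negligible; first by apply: measurableU => //; exact: measurableD.
    by apply: negligibleU; apply/negligibleP => //; exact: measurableD.
  - move=> x /= h; apply: contrapT => /not_orP[Nx /not_andP[/(_ (CN x Nx))|/contrapT Ax]]//.
    by apply: h; exact: ucy.
have lcyfin : \int[Q]_x (lam%:E * cy x) \is a fin_num.
  by rewrite ge0_fin_numE//; apply: integral_ge0.
have := le_trans uLy (transport_integral_le mL my rP Doo cyoo).
rewrite -lcyE leeD2rE// => ule.
(* The near-optimality loss [d] costs exactly [lam * d = e] in the integral. *)
have -> : \int[Q]_x (lam%:E * f x) = \int[Q]_x (lam%:E * (f x - d%:E)) + e%:E.
  rewrite -[e%:E in RHS](integral_cst_prob Q).
  rewrite -integralD_ge0//; last 2 first.
  - by move=> x; rewrite lee_fin ltW.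
  - by rewrite integral_cst_prob ltry.
  apply: eq_integral => x _; rewrite -lamd /=.
  have := foo x; case: (f x) => [a| |]// _.
    by rewrite -!EFinD; congr (_%:E); rewrite mulrBr subrK.
  by rewrite !gt0_muleNy ?lte_fin// addNye.
exact: leeD2r.
Qed.

Lemma le_Lc L1 L2 x : (forall y, L1 y <= L2 y) -> Lc L1 c lam x <= Lc L2 c lam x.
Proof.
move=> L12; apply: ge_ereal_sup => _ [y _ <-].
apply: (@le_trans _ _ (L2 y * (lam^-1)%:E - c x y)).
  by apply: leeD2r; apply: lee_wpmul2r => //; rewrite lee_fin invr_ge0 ltW.
by apply: ereal_sup_ubound; exists y.
Qed.

(** This shift makes the truncated functions nonnegative for monotone convergence. *)
Lemma cexpectD_cst L Q (k : R) : (0 <= k)%R ->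
  measurable_fun setT (L : Borel X -> \bar R) ->
  cexpect Q (fun x => lam%:E * Lc L c lam x + k%:E) =
  cexpect Q (fun x => lam%:E * Lc L c lam x) + k%:E.
Proof.
move=> k0 mL; have [f [N [mf mN QN _ fN]]] := Lc_version Q mL.
have mlf : measurable_fun setT (fun x => lam%:E * f x) by exact: measurable_funeM.
rewrite (cexpect_version (g := fun x => lam%:E * Lc L c lam x)
  (f := fun x => lam%:E * f x) mlf mN QN); last first.
  by move=> x /fN ->.
rewrite (cexpect_version (f := fun x => lam%:E * f x + k%:E) _ mN QN); last 2 first.
- by apply: emeasurable_funD.
- by move=> x /fN ->.
rewrite -[k%:E in RHS](integral_cst_prob Q) -integralD_ge0//.
by rewrite integral_cst_prob ltry.
Qed.

(** The truncations [min L n] fall under the bounded case with the same [r]. Their transforms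
    increase to [Lc L], and monotone convergence for the completed measure passes to the limit. *)
Lemma cexpect_le_bounded_below L Q (r : \bar R) (m : R) :
  (forall x, c x x = 0) ->
  measurable_fun setT (L : Borel X -> \bar R) ->
  (forall x, L x < +oo) -> (forall x, m%:E <= L x) ->
  (forall nu, Dc D c nu P < +oo -> \int[nu]_x L x - lam%:E * Dc D c nu P <= r) ->
  D Q P < +oo ->
  cexpect Q (fun x => lam%:E * Lc L c lam x) <= r + lam%:E * D Q P.
Proof.
move=> cxx mL Loo mLx rP Doo.
(* With [m <= 0], truncation at [n >= 0] preserves the lower bound and the shift by [- m] is
   nonnegative. *)
wlog m0 : m mLx / (m <= 0)%R.
  move=> /(_ (Num.min m 0)%R); apply; last by rewrite ge_min lexx orbT.
  by move=> x; apply: le_trans (mLx x); rewrite lee_fin ge_min lexx.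
pose Ln n x := mine (L x) n%:R%:E.
have mLn n : measurable_fun setT (Ln n : Borel X -> \bar R) by exact: measurable_mine.
have LnL n x : Ln n x <= L x by rewrite ge_min lexx.
have Lnn n x : Ln n x <= n%:R%:E by rewrite ge_min lexx orbT.
have mLnx n x : m%:E <= Ln n x.
  by rewrite le_min mLx lee_fin (le_trans m0).
have Ln_nd x : {homo Ln^~ x : i j / (i <= j)%N >-> i <= j}.
  by move=> i j ij; apply: le_min2 => //; rewrite lee_fin ler_nat.
have EnK n : cexpect Q (fun x => lam%:E * Lc (Ln n) c lam x) <= r + lam%:E * D Q P.
  apply: (cexpect_le_bounded cxx (mLn n) (Lnn n) _ Doo).
  move=> nu nuoo; apply: le_trans (rP nu nuoo); apply: leeB => //.
  by apply: ae_le_integralT => //; exact: aeW.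
have k0 : (0 <= - m)%R by rewrite oppr_ge0.
pose u L x := lam%:E * Lc L c lam x + (- m)%:E.
pose cT := caratheodory_type (mu_ext Q).
have mu' n : measurable_fun setT (u (Ln n) : cT -> \bar R).
  have [f [N [mf mN QN _ fN]]] := Lc_version Q (mLn n).
  apply: (version_measurable_completed (f := fun x => lam%:E * f x + (- m)%:E) _ mN QN).
    by apply: emeasurable_funD => //; exact: measurable_funeM.
  by move=> x /fN ->.
have u0 n x : 0 <= u (Ln n) x.
  rewrite -leeBlDr// sub0e -EFinN opprK -lee_pdivrMl//.
  (* Choosing [y = x] in the supremum costs nothing and gives the lower bound [m / lam]. *)
  apply: (@le_trans _ _ (Ln n x * (lam^-1)%:E - c x x)).
    by rewrite cxx sube0 muleC lee_wpmul2r// lee_fin invr_ge0 ltW.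
  by apply: ereal_sup_ubound; exists x.
have u_nd x : {homo (fun n => u (Ln n) x) : i j / (i <= j)%N >-> i <= j}.
  move=> i j ij; apply: leeD2r; rewrite lee_pmul2l//.
  by apply: le_Lc => y; exact: Ln_nd.
have limu x : limn (fun n => u (Ln n) x) = u L x.
  have /cvg_lim -> // := ereal_nondecreasing_cvgn (u_nd x).
  apply/eqP; rewrite eq_le; apply/andP; split.
    apply: ge_ereal_sup => _ [n _ <-]; apply: leeD2r; rewrite lee_pmul2l//.
    exact: le_Lc.
  set S := ereal_sup _.
  rewrite /u -leeBrDr// -lee_pdivlMl//.
  apply: ge_ereal_sup => _ [y _ <-].
  (* Since [L y] is finite, each competitor [y] is eventually untruncated, so the suprema over [n]
     and [y] can be exchanged. *)
  have [n Lyn] : exists n, L y <= n%:R%:E.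
    have := Loo y; have := mLx y; case: (L y) => [l| |]// _ _.
    exists (Num.bound `|l|); rewrite lee_fin ltW//.
    exact: le_lt_trans (ler_norm l) (archi_boundP (normr_ge0 l)).
  have -> : L y = Ln n y by rewrite /Ln min_l.
  apply: (@le_trans _ _ (Lc (Ln n) c lam x)).
    by apply: ereal_sup_ubound; exists y.
  rewrite lee_pdivlMl// leeBrDr//.
  by apply: ereal_sup_ubound; exists n.
rewrite -(@leeD2rE _ (- m)%:E)// -cexpectD_cst//.
rewrite /cexpect -/(u L).
under eq_integral do rewrite -/(u L _) -limu.
have := @cvg_monotone_convergence _ cT R (@completed_measure_extension _ (Borel X) R Q)
  setT measurableT (fun n => u (Ln n)) mu' (fun n x _ => u0 n x) (fun x _ => u_nd x).
move=> /[dup] /cvg_lim <- // cv; apply: lime_le; first by apply/cvg_ex; eexists; exact: cv.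
apply: nearW => n; rewrite -/(cexpect Q (u (Ln n))) cexpectD_cst//.
exact: leeD2r.
Qed.

End duality.

Theorem theorem6 (R : realType) (X : completePseudoMetricType R)
  (L : X -> \bar R) (P : @pmeasure R X)
  (D : @pmeasure R X -> @pmeasure R X -> \bar R) (c : X -> X -> \bar R) :
  @polish R X ->
  measurable_fun (setT : set (Borel X)) (L : Borel X -> \bar R) ->
  (forall x, L x < +oo) ->
  ((exists m : R, forall x, m%:E <= L x) \/ (exists M : R, forall x, L x <= M%:E)) ->
  pre_divergence D ->
  convex_first_arg D P ->
  cost_function c ->
  (forall x, c x x = 0) ->
  forall lam : R, (0 < lam)%R ->
    universally_measurable (Lc L c lam) /\
    ereal_sup [set \int[Q]_x L x - lam%:E * Dc D c Q P
                | Q in [set Q : pmeasure | Dc D c Q P < +oo]]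
    = ereal_sup [set cexpect Q (fun x => lam%:E * Lc L c lam x) - lam%:E * D Q P
                | Q in [set Q : pmeasure | D Q P < +oo]].
Proof.
move=> polishX mL Loo Lb [D0 _] _ costc cxx lam lam0; split.
  exact: Lc_universally_measurable.
apply/eqP; rewrite eq_le; apply/andP; split; apply: ge_ereal_sup => _ [Q Qoo <-].
  apply: integral_sub_Dc_le => // eta etaoo.
  by apply: ereal_sup_ubound; exists eta.
rewrite leeBlDr; last by rewrite fin_numM// ge0_fin_numE.
have rP nu : Dc D c nu P < +oo -> \int[nu]_x L x - lam%:E * Dc D c nu P <=
    ereal_sup [set \int[Q]_x L x - lam%:E * Dc D c Q P
                | Q in [set Q : pmeasure | Dc D c Q P < +oo]].
  by move=> nuoo; apply: ereal_sup_ubound; exists nu.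
case: Lb => [[m Lm]|[M LM]].
  exact: (cexpect_le_bounded_below polishX D0 costc lam0 cxx mL Loo Lm rP Qoo).
exact: (cexpect_le_bounded polishX D0 costc lam0 cxx mL LM rP Qoo).
Qed.
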